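(* Let $n\ge 2$. If $n\ne 6$, then any automorphism $\phi\in\operatorname{Aut}(S_n)$ can be lifted to an automorphism of $B_n$. Further, a non-inner automorphism of $S_6$ cannot be lifted to an automorphism of $B_6$.
   Context: $B_n$ is the Artin braid group with standard generators $\sigma_1,\dots,\sigma_{n-1}$, and $\pi:B_n\to S_n$ is the homomorphism $\sigma_i\mapsto(i\ i+1)$, with kernel the pure braid group $P_n$ (a characteristic subgroup of $B_n$). A lift of $\phi\in\operatorname{Aut}(S_n)$ is an automorphism $\tilde\phi$ of $B_n$ with $\pi\circ\tilde\phi=\phi\circ\pi$. *)

(* Defs.v *)
From HB Require Import structures.
From mathcomp Require Import all_boot all_fingroup.
From mathcomp Require Import generic_quotient boolp.

Set Implicit Arguments.
Unset Strict Implicit.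
Unset Printing Implicit Defensive.

Import GroupScope.
Local Open Scope quotient_scope.

(* The Artin braid group on n strands is the group with generators            *)
(* sigma_0, .., sigma_(n-2) (indices are shifted down by one, as strands are  *)
(* numbered by 'I_n) and relations                                            *)
(*    sigma_i sigma_j = sigma_j sigma_i                  for |i - j| > 1,     *)
(*    sigma_i sigma_j sigma_i = sigma_j sigma_i sigma_j  for |i - j| = 1.     *)
(* It is built as a quotient of the words in the letters (i, b), where        *)
(* (i, false) stands for sigma_i and (i, true) for its inverse.               *)

Definition braid_letter n := ('I_n.-1 * bool)%type.
Definition braid_word n := seq (braid_letter n).

Inductive braid_eqv n : braid_word n -> braid_word n -> Prop :=
| BraidCancel u v i b :
    braid_eqv (u ++ [:: (i, b); (i, ~~ b)] ++ v) (u ++ v)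
| BraidComm u v (i j : 'I_n.-1) : i.+1 < j ->
    braid_eqv (u ++ [:: (i, false); (j, false)] ++ v)
              (u ++ [:: (j, false); (i, false)] ++ v)
| BraidBraid u v (i j : 'I_n.-1) : i.+1 = j ->
    braid_eqv (u ++ [:: (i, false); (j, false); (i, false)] ++ v)
              (u ++ [:: (j, false); (i, false); (j, false)] ++ v)
| BraidRefl u : braid_eqv u u
| BraidSym u v : braid_eqv u v -> braid_eqv v u
| BraidTrans v u w : braid_eqv u v -> braid_eqv v w -> braid_eqv u w.

Section BraidGroup.
Variable n : nat.
Implicit Types u v w : braid_word n.

Lemma braid_eqv_cat u1 v1 u2 v2 :
  braid_eqv u1 v1 -> braid_eqv u2 v2 -> braid_eqv (u1 ++ u2) (v1 ++ v2).
Proof.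
move=> e1 e2; apply: (@BraidTrans _ (v1 ++ u2)).
  elim: e1 => [u v i b|u v i j ij|u v i j ij|u|u v _ e|u v w _ e _ e'].
  - by rewrite -!catA; apply: BraidCancel.
  - by rewrite -!catA; apply: BraidComm.
  - by rewrite -!catA; apply: BraidBraid.
  - exact: BraidRefl.
  - exact: BraidSym.
  - exact: BraidTrans e e'.
elim: e2 => [u v i b|u v i j ij|u v i j ij|u|u v _ e|u v w _ e _ e'].
- by rewrite !(catA v1); apply: BraidCancel.
- by rewrite !(catA v1); apply: BraidComm.
- by rewrite !(catA v1); apply: BraidBraid.
- exact: BraidRefl.
- exact: BraidSym.
- exact: BraidTrans e e'.
Qed.

Definition braid_word_inv w := rev [seq (x.1, ~~ x.2) | x <- w].

Lemma braid_word_invK : involutive braid_word_inv.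
Proof.
move=> w; rewrite /braid_word_inv map_rev revK -map_comp map_id_in //.
by case=> i b _ /=; rewrite negbK.
Qed.

Lemma braid_word_mulVw w : braid_eqv (braid_word_inv w ++ w) [::].
Proof.
elim: w => [|[i b] w IHw]; first exact: BraidRefl.
rewrite /braid_word_inv /= rev_cons -cats1 -catA /=.
apply: BraidTrans IHw.
by have := BraidCancel (braid_word_inv w) w i (~~ b); rewrite negbK.
Qed.

Lemma braid_word_mulwV w : braid_eqv (w ++ braid_word_inv w) [::].
Proof. by have := braid_word_mulVw (braid_word_inv w); rewrite braid_word_invK. Qed.

Lemma braid_eqv_inv u v :
  braid_eqv u v -> braid_eqv (braid_word_inv u) (braid_word_inv v).
Proof.
move=> e; set u' := braid_word_inv u; set v' := braid_word_inv v.
apply: (@BraidTrans _ (u' ++ v ++ v')).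
  rewrite -[X in braid_eqv X _]cats0.
  apply: braid_eqv_cat; first exact: BraidRefl.
  by apply: BraidSym; apply: braid_word_mulwV.
rewrite catA -[X in braid_eqv _ X]cat0s.
apply: braid_eqv_cat; last exact: BraidRefl.
apply: BraidTrans (braid_word_mulVw u).
by apply: braid_eqv_cat; [apply: BraidRefl | apply: BraidSym].
Qed.

Definition braid_eqb : rel (braid_word n) := fun u v => `[< braid_eqv u v >].

Lemma braid_eqb_refl : reflexive braid_eqb.
Proof. by move=> u; apply/asboolP; apply: BraidRefl. Qed.

Lemma braid_eqb_sym : symmetric braid_eqb.
Proof. by move=> u v; apply/asboolP/asboolP; apply: BraidSym. Qed.

Lemma braid_eqb_trans : transitive braid_eqb.
Proof.
move=> v u w /asboolP uv /asboolP vw; apply/asboolP; exact: BraidTrans uv vw.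
Qed.

Canonical braid_eqb_equiv :=
  EquivRel braid_eqb braid_eqb_refl braid_eqb_sym braid_eqb_trans.

Definition braid := {eq_quot braid_eqb}.
HB.instance Definition _ := Choice.on braid.

Definition braid_class w : braid := \pi_braid w.

Lemma braid_classP u v : reflect (braid_class u = braid_class v) (braid_eqb u v).
Proof. by apply: (iffP idP) => /eqmodP. Qed.

Lemma braid_class_eqv u v : braid_class u = braid_class v <-> braid_eqv u v.
Proof. by split=> [/braid_classP/asboolP //|e]; apply/braid_classP/asboolP. Qed.

Lemma braid_reprK (x : braid) : braid_class (repr x) = x.
Proof. exact: reprK. Qed.

Definition braid_one : braid := braid_class [::].
Definition braid_mul (x y : braid) : braid := braid_class (repr x ++ repr y).
Definition braid_inv (x : braid) : braid := braid_class (braid_word_inv (repr x)).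

Lemma braid_mul_class u v :
  braid_mul (braid_class u) (braid_class v) = braid_class (u ++ v).
Proof.
by apply/braid_class_eqv/braid_eqv_cat; apply/braid_class_eqv; apply: braid_reprK.
Qed.

Lemma braid_inv_class u :
  braid_inv (braid_class u) = braid_class (braid_word_inv u).
Proof. by apply/braid_class_eqv/braid_eqv_inv/braid_class_eqv/braid_reprK. Qed.

Lemma braid_mulA : associative braid_mul.
Proof.
move=> x y z; rewrite -(braid_reprK x) -(braid_reprK y) -(braid_reprK z).
by rewrite !braid_mul_class catA.
Qed.

Lemma braid_mul1g : left_id braid_one braid_mul.
Proof. by move=> x; rewrite -(braid_reprK x) braid_mul_class. Qed.

Lemma braid_mulg1 : right_id braid_one braid_mul.
Proof. by move=> x; rewrite -(braid_reprK x) braid_mul_class cats0. Qed.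

Lemma braid_mulVg : left_inverse braid_one braid_inv braid_mul.
Proof.
move=> x; rewrite -(braid_reprK x) braid_inv_class braid_mul_class.
exact/braid_class_eqv/braid_word_mulVw.
Qed.

Lemma braid_mulgV : right_inverse braid_one braid_inv braid_mul.
Proof.
move=> x; rewrite -(braid_reprK x) braid_inv_class braid_mul_class.
exact/braid_class_eqv/braid_word_mulwV.
Qed.

HB.instance Definition _ := isGroup.Build braid
  braid_mulA braid_mul1g braid_mulg1 braid_mulVg braid_mulgV.

Definition sigma (i : 'I_n.-1) : braid := braid_class [:: (i, false)].

Lemma braid_classM u v : braid_class (u ++ v) = braid_class u * braid_class v.
Proof. by rewrite -braid_mul_class. Qed.

Lemma braid_classV u : braid_class (braid_word_inv u) = (braid_class u)^-1.
Proof. by rewrite -braid_inv_class. Qed.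

Lemma sigma_comm (i j : 'I_n.-1) :
  i.+1 < j -> sigma i * sigma j = sigma j * sigma i.
Proof.
by move=> ij; rewrite -!braid_classM; apply/braid_class_eqv/(BraidComm [::] [::]).
Qed.

Lemma sigma_braid (i j : 'I_n.-1) :
  i.+1 = j -> sigma i * sigma j * sigma i = sigma j * sigma i * sigma j.
Proof.
move=> ij; rewrite -!(braid_classM [:: _] [:: _]) -!(braid_classM [:: _; _]).
by apply/braid_class_eqv; exact: (BraidBraid [::] [::] ij).
Qed.

(* The universal property of the presentation.                                *)
Section Lift.
Variables (G : groupType) (s : 'I_n.-1 -> G).

Definition braid_word_eval w : G :=
  \prod_(x <- w) (if x.2 then (s x.1)^-1 else s x.1).

Definition braid_lift (x : braid) : G := braid_word_eval (repr x).

Hypothesis s_comm : forall i j : 'I_n.-1, i.+1 < j -> s i * s j = s j * s i.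
Hypothesis s_braid :
  forall i j : 'I_n.-1, i.+1 = j -> s i * s j * s i = s j * s i * s j.

Lemma braid_word_eval_eqv u v :
  braid_eqv u v -> braid_word_eval u = braid_word_eval v.
Proof.
rewrite /braid_word_eval.
elim=> // [{}u {}v i b|{}u {}v i j ij|{}u {}v i j ij|{}u {}w {}v _ -> _ ->] //.
- rewrite !big_cat !big_cons big_nil /= mulg1.
  by case: b => /=; rewrite ?mulVg ?mulgV mul1g.
- by rewrite !big_cat !big_cons !big_nil /= !mulg1 s_comm.
- rewrite !big_cat !big_cons !big_nil /= !mulg1.
  by congr (_ * (_ * _)); rewrite !mulgA s_braid.
Qed.

Lemma braid_lift_class w : braid_lift (braid_class w) = braid_word_eval w.
Proof. by apply/braid_word_eval_eqv/braid_class_eqv/braid_reprK. Qed.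

Lemma braid_liftM : {morph braid_lift : x y / x * y}.
Proof.
move=> x y; rewrite -(braid_reprK x) -(braid_reprK y) -braid_classM.
by rewrite !braid_lift_class /braid_word_eval big_cat.
Qed.

Lemma braid_lift_sigma i : braid_lift (sigma i) = s i.
Proof.
by rewrite braid_lift_class /braid_word_eval big_cons big_nil mulg1.
Qed.

Lemma braid_lift_uniq (f : braid -> G) :
    {morph f : x y / x * y} -> (forall i, f (sigma i) = s i) ->
  f =1 braid_lift.
Proof.
move=> fM fs x; rewrite -(braid_reprK x) braid_lift_class.
have f1 : f 1 = 1 by apply: (mulgI (f 1)); rewrite -fM !mulg1.
elim: (repr x) => [|[i b] w IHw]; first by rewrite /braid_word_eval big_nil.
rewrite -cat1s braid_classM fM IHw /braid_word_eval big_cat big_seq1 /=.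
congr (_ * _); case: b; last exact: fs.
apply: (mulIg (f (sigma i))); rewrite /= -fs.
rewrite mulVg -fM -f1; congr f; rewrite -braid_classM.
by apply/braid_class_eqv; exact: (BraidCancel [::] [::] i true).
Qed.

End Lift.
End BraidGroup.

Notation "''B_' n" := (braid n)
  (at level 8, n at level 2, format "''B_' n") : type_scope.

Lemma ltn_pred_ord n (i : 'I_n.-1) : i < n.
Proof. exact: leq_trans (ltn_ord i) (leq_pred n). Qed.

Lemma ltnS_pred_ord n (i : 'I_n.-1) : i.+1 < n.
Proof. by case: n i => [[]|n i] //=; rewrite ltnS. Qed.

Definition adj_tperm n (i : 'I_n.-1) : 'S_n :=
  tperm (Ordinal (ltn_pred_ord i)) (Ordinal (ltnS_pred_ord i)).

Lemma adj_tperm_comm n (i j : 'I_n.-1) : i.+1 < j ->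
  adj_tperm i * adj_tperm j = adj_tperm j * adj_tperm i.
Proof.
move=> ij; apply/commgP/conjg_fixP; rewrite tpermJ.
have ijN : i < j by exact: ltnW.
by rewrite !tpermD // -val_eqE /= gtn_eqF // ltnS ltnW.
Qed.

Lemma adj_tperm_braid n (i j : 'I_n.-1) : i.+1 = j ->
  adj_tperm i * adj_tperm j * adj_tperm i =
  adj_tperm j * adj_tperm i * adj_tperm j.
Proof.
rewrite /adj_tperm => ij; set a := Ordinal _; set b := Ordinal _.
set c := Ordinal _; set d := Ordinal _.
have -> : c = b by apply: val_inj; rewrite /= ij.
have ab : a != b by rewrite -val_eqE /= ltn_eqF.
have ad : a != d by rewrite -val_eqE /= -ij ltn_eqF.
have bd : b != d by rewrite -val_eqE /= -ij ltn_eqF.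
have -> : tperm a b * tperm b d * tperm a b = tperm a d.
  by rewrite -{1}(tpermV a b) -mulgA -conjgE tpermJ tpermR tpermD.
rewrite -{1}(tpermV b d) -mulgA -conjgE tpermJ tpermL tpermD //.
  by rewrite eq_sym.
by rewrite eq_sym.
Qed.

Definition braid_perm n : 'B_n -> 'S_n := braid_lift (@adj_tperm n).

Lemma braid_permM n : {morph @braid_perm n : x y / x * y}.
Proof. exact: braid_liftM (@adj_tperm_comm n) (@adj_tperm_braid n). Qed.

Lemma braid_perm_sigma n (i : 'I_n.-1) : braid_perm (sigma i) = adj_tperm i.
Proof. exact: braid_lift_sigma (@adj_tperm_comm n) (@adj_tperm_braid n) i. Qed.

HB.instance Definition _ n :=
  isMultiplicative.Build 'B_n 'S_n (@braid_perm n) (@braid_permM n).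

(* [Aut G] of the library is only available for finite groups.                *)
Definition is_automorphism (G : groupType) (f : G -> G) : Prop :=
  {morph f : x y / x * y} /\ bijective f.

Definition is_lift n (phi : {perm 'S_n}) (f : 'B_n -> 'B_n) : Prop :=
  is_automorphism f /\ forall x, braid_perm (f x) = phi (braid_perm x).

Definition Inn (gT : finGroupType) (G : {group gT}) : {set {perm gT}} :=
  conj_aut G @* G.

Lemma InnP (gT : finGroupType) (phi : {perm gT}) :
  reflect (exists x, forall y, phi y = y ^ x) (phi \in Inn [set: gT]).
Proof.
apply: (iffP idP) => [/morphimP[x _ _ ->] | [x phiE]].
  by exists x => y; rewrite conj_autE ?inE.
have -> : phi = conj_aut [set: gT] x.
  by apply/permP => y; rewrite phiE conj_autE ?inE.
by apply: mem_morphim; rewrite ?(subsetP (normG [set: gT])) ?in_setT.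
Qed.

(* Main.v *)
From HB Require Import structures.
Require Import Defs.
From mathcomp Require Import all_boot all_fingroup.
From mathcomp Require Import cyclic pgroup sylow ssralg zmodp.
From mathcomp Require Import generic_quotient boolp.

(** An automorphism phi of a symmetric group preserves the orders of products.
    Two transpositions have a product of order 1, 2 or 3, so the same holds for
    the image of a transposition and each of its conjugates. An involution with
    this property is a transposition, or is fixed-point-free with two or three
    cycles ([involution_6_products]). A product of two disjoint transpositions
    is even and cannot be the image of a transposition; the triple ones live on
    six points. If phi maps transpositions to transpositions, then it maps the
    star of transpositions (o i) to another star, whose labelling is a
    permutation that induces phi by conjugation ([transposition_aut_inner]).
    Thus phi is inner, or else there are six points and all transpositions have
    fixed-point-free images ([perm_aut_inner_or_exotic]). As braids map onto
    permutations, inner automorphisms lift to conjugations by braids.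

    To exclude lifts in the exotic case, record for each braid how many times,
    with sign, each strand is the one in position i at an occurrence of sigma i.
    These counts form a 1-cocycle, i.e. the second component of a homomorphism
    to a wreath product lying over the projection to permutations, and their
    total is the exponent sum. Let f lift phi and let x be the image of
    sigma 0. It commutes with the image h of sigma 2 sigma 3, hence the counts
    of the pure braid x * x are invariant under the permutation z of h. This z
    is the image under phi of a 3-cycle disjoint from the transposition of
    sigma 0, so it commutes with a fixed-point-free involution on six points,
    and has no fixed point itself ([commuting_order3_fpf]). Its orbits all have
    size 3, so the exponent sum of x * x vanishes modulo 3, and so does that of
    x. But then all braids in the image of f have an exponent sum divisible by
    3, and f is not surjective ([exotic_no_lift]). *)

Set Implicit Arguments.
Unset Strict Implicit.
Unset Printing Implicit Defensive.

Import GroupScope.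

(** * Involutions that multiply like transpositions *)

Section Transpositions.
Variable T : finType.
Implicit Types (a b c d e : T) (x y z g : {perm T}).

Definition transposition x := exists a b, a != b /\ x = tperm a b.

(** Two transpositions either commute or satisfy the braid relation, so that
    their product has order 1, 2 or 3. The exponent 6 states this uniformly,
    in a form that every automorphism preserves. *)
Lemma tperm_mul_exp6 a b c d : (tperm a b * tperm c d) ^+ 6 = 1.
Proof.
have sq6 x : x * x = 1 -> x ^+ 6 = 1.
  by move=> xx; rewrite (expgM _ 2 3) (_ : x ^+ 2 = 1) ?expg1n // expgS expg1.
have braid_exp6 x y : x * x = 1 -> y * y = 1 -> x * y * x = y * x * y ->
    (x * y) ^+ 6 = 1.
  move=> xx yy xyx; rewrite (expgM _ 3 2) [_ ^+ 3](_ : _ = 1) ?expg1n //.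
  have ->: (x * y) ^+ 3 = (x * y * x) * (y * x * y).
    by rewrite !expgS mulg1 !mulgA.
  by rewrite xyx -!mulgA (mulgA y y) yy mul1g (mulgA x x) xx mul1g yy.
have tt a1 b1 : tperm a1 b1 * tperm a1 b1 = 1 by rewrite -{1}tpermV mulVg.
have shared a1 b1 d1 : (tperm a1 b1 * tperm a1 d1) ^+ 6 = 1.
  have [->|ab] := eqVneq a1 b1; first by rewrite tperm1 mul1g sq6.
  have [->|ad] := eqVneq a1 d1; first by rewrite tperm1 mulg1 sq6.
  have [->|bd] := eqVneq b1 d1; first by rewrite tt expg1n.
  apply: braid_exp6; rewrite ?tt //.
  rewrite -{1}(tpermV a1 b1) -mulgA -conjgE tpermJ tpermL tpermD //.
  rewrite [RHS](_ : _ = tperm a1 b1 ^ tperm a1 d1).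
    by rewrite tpermJ tpermL tpermD // 1?eq_sym // tpermC.
  by rewrite conjgE tpermV mulgA.
have [->|ac] := eqVneq a c; first exact: shared.
have [->|ad] := eqVneq a d; first by rewrite (tpermC c d).
have [->|bc] := eqVneq b c; first by rewrite (tpermC a c).
have [->|bd] := eqVneq b d; first by rewrite (tpermC a d) (tpermC c d).
rewrite expgMn; last first.
  by apply/commgP/conjg_fixP; rewrite tpermJ !tpermD // eq_sym.
by rewrite !sq6 ?mulg1.
Qed.

Lemma cycle_perm_exists a0 (s : seq T) : uniq s ->
  exists g, forall i, i < size s ->
    g (nth a0 s i) = nth a0 s (i.+1 %% size s).
Proof.
move=> Us; exists (perm (can_inj (prev_next Us))) => i lt_i.
rewrite permE next_nth mem_nth // index_uniq //.
case: s Us lt_i => //= y s Us; rewrite ltnS leq_eqVlt => /predU1P[-> | lt_i].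
  by rewrite modnn nth_default.
by rewrite modn_small // (set_nth_default a0).
Qed.

(** With g the 5-cycle (a b c d e), the involutions x = (a b)(c d).. and
    x ^ g = (b c)(d e).. alternate along the path a, b, c, d, e, and their
    product is a 5-cycle on these points. *)
Lemma double_tperm_conj_prod x a b c d e :
    uniq [:: a; b; c; d; e] -> x a = b -> x b = a -> x c = d -> x d = c ->
    x e = e ->
  exists g, (x * x ^ g) ^+ 6 != 1.
Proof.
move=> Us xa xb xc xd xe; have [g gE] := cycle_perm_exists a Us; exists g.
have [[ga gb] gc] := (gE 0 isT, gE 1%N isT, gE 2 isT).
have [gd ge] := (gE 3 isT, gE 4 isT).
rewrite /= in ga gb gc gd ge.
have pa : (x * x ^ g) a = c by rewrite permM xa -ga permJ xa gb.
have pc : (x * x ^ g) c = e by rewrite permM xc -gc permJ xc gd.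
have pe : (x * x ^ g) e = d by rewrite permM xe -gd permJ xd gc.
have pd : (x * x ^ g) d = b by rewrite permM xd -gb permJ xb ga.
have pb : (x * x ^ g) b = a by rewrite permM xb -ge permJ xe ge.
apply/eqP; move/permP/(_ a); rewrite permX /= pa pc pe pd pb pa perm1 => ca.
by move: Us; rewrite /= ca !inE eqxx !orbT.
Qed.

(** With g the 8-cycle (a1 b1 a2 b2 a3 b3 a4 b4), the involutions x and x ^ g
    alternate along an octagon, and their product acts as the 4-cycle
    (a1 a2 a3 a4) on every other vertex. *)
Lemma quadruple_tperm_conj_prod x a1 b1 a2 b2 a3 b3 a4 b4 :
    uniq [:: a1; b1; a2; b2; a3; b3; a4; b4] ->
    x a1 = b1 -> x b1 = a1 -> x a2 = b2 -> x b2 = a2 ->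
    x a3 = b3 -> x b3 = a3 -> x a4 = b4 -> x b4 = a4 ->
  exists g, (x * x ^ g) ^+ 6 != 1.
Proof.
move=> Us xa1 xb1 xa2 xb2 xa3 xb3 xa4 xb4.
have [g gE] := cycle_perm_exists a1 Us; exists g.
have [[[ga1 gb1] ga2] gb2] := (gE 0 isT, gE 1%N isT, gE 2 isT, gE 3 isT).
have [[[ga3 gb3] ga4] gb4] := (gE 4 isT, gE 5 isT, gE 6 isT, gE 7 isT).
rewrite /= in ga1 ga2 ga3 ga4 gb1 gb2 gb3 gb4.
have p1 : (x * x ^ g) a1 = a2 by rewrite permM xa1 -{1}ga1 permJ xa1 gb1.
have p2 : (x * x ^ g) a2 = a3 by rewrite permM xa2 -{1}ga2 permJ xa2 gb2.
have p3 : (x * x ^ g) a3 = a4 by rewrite permM xa3 -{1}ga3 permJ xa3 gb3.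
have p4 : (x * x ^ g) a4 = a1 by rewrite permM xa4 -{1}ga4 permJ xa4 gb4.
apply/eqP; move/permP/(_ a1); rewrite permX /= p1 p2 p3 p4 p1 p2 perm1 => a31.
by move: Us; rewrite /= a31 !inE eqxx !orbT.
Qed.

(** The property of transpositions in [tperm_mul_exp6] nearly characterises
    them among the involutions: a second moved pair together with a fixed point
    is ruled out by [double_tperm_conj_prod], and four moved pairs are ruled out
    by [quadruple_tperm_conj_prod]. There remain the fixed-point-free
    involutions with two or three pairs, which are genuine exceptions. *)
Lemma involution_6_products x :
    x * x = 1 -> x != 1 -> (forall g, (x * x ^ g) ^+ 6 = 1) ->
  transposition x \/
  (forall e, x e != e) /\
  (#|T| = 6 \/
   exists a b c d, [/\ a != b, c != d & x = tperm a b * tperm c d]).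
Proof.
move=> xx x1 x6; have xK a : x (x a) = a by rewrite -permM xx perm1.
have nogood g : (x * x ^ g) ^+ 6 != 1 -> False by rewrite x6 eqxx.
have [a xa] : exists a, x a != a.
  apply/existsP; apply: contraNT x1 => /existsPn fix_x.
  by apply/eqP/permP => a; rewrite perm1; apply/eqP/negPn/fix_x.
have [->|x_ab] := eqVneq x (tperm a (x a)).
  by left; exists a, (x a); rewrite eq_sym.
have [c xc] : exists c, x c != tperm a (x a) c.
  apply/existsP; apply: contraNT x_ab => /existsPn x_ab.
  by apply/eqP/permP => c; apply/eqP/negPn/x_ab.
have ca : c != a by apply: contraNneq xc => ->; rewrite tpermL.
have cxa : c != x a by apply: contraNneq xc => ->; rewrite tpermR xK.
have {}xc : x c != c by move: xc; rewrite tpermD // eq_sym.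
have Us4 : uniq [:: a; x a; c; x c].
  rewrite /= !inE !negb_or (inj_eq perm_inj) !(eq_sym _ c) !(eq_sym a).
  rewrite xa ca cxa (eq_sym c) xc.
  by rewrite -(inj_eq (@perm_inj _ x)) xK cxa.
have [fpf | /forallPn[e]] := boolP [forall e, x e != e]; last first.
  rewrite negbK => /eqP xe.
  have Us : uniq [:: a; x a; c; x c; e].
    rewrite -[_ :: _]/(rcons [:: _; _; _; _] e) rcons_uniq Us4 andbT.
    rewrite !inE; apply/or4P=> -[] /eqP E; move/eqP: xe; rewrite E ?xK;
      by rewrite ?(eq_sym a) ?(eq_sym c) ?(negPf xa) ?(negPf xc).
  by have [g /nogood] := double_tperm_conj_prod Us erefl (xK a) erefl (xK c) xe.
right; split; first exact/forallP.
have {}fpf e : x e != e by apply/forallP: e.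
have grow (s : seq T) e : (forall y : T, y \in s -> x y \in s) ->
    uniq s -> e \notin s -> uniq (s ++ [:: e; x e]).
  move=> s_x Us es.
  rewrite cat_uniq Us /= !inE [e == _]eq_sym fpf !andbT orbF negb_or es.
  by apply: contra es => /s_x; rewrite xK.
have s4 (y : T) : y \in [:: a; x a; c; x c] -> x y \in [:: a; x a; c; x c].
  by rewrite !inE => /or4P[] /eqP->; rewrite ?xK eqxx ?orbT.
have card_s (s : seq T) : uniq s -> (forall e, e \in s) -> #|T| = size s.
  move=> Us s_T; rewrite -(card_uniqP Us).
  by apply/esym/eq_card => e; rewrite s_T.
have [T4 | /forallPn[e es4]] := boolP [forall e, e \in [:: a; x a; c; x c]].
  right; exists a, (x a), c, (x c); split; rewrite 1?eq_sym //.
  move: (Us4); rewrite /= !inE !negb_or.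
  case/and4P=> /and3P[n1 n2 n3] /andP[n4 n5] n6 _.
  apply/permP => e; move/forallP/(_ e): T4.
  rewrite permM !inE => /or4P[] /eqP->.
  - by rewrite tpermL tpermD 1?eq_sym.
  - by rewrite tpermR tpermD ?xK 1?eq_sym.
  - by rewrite (@tpermD _ a) // tpermL.
  - by rewrite (@tpermD _ a) // tpermR xK.
left; have Us6 := grow _ _ s4 Us4 es4.
set s := _ ++ _ in Us6.
have [T6 | /forallPn[h hs]] := boolP [forall e, e \in s].
  by rewrite (card_s _ Us6) // => h; apply/forallP: h.
have s6 (y : T) : y \in s -> x y \in s.
  rewrite !mem_cat => /orP[/s4-> // | ]; rewrite !inE.
  by case/pred2P=> ->; rewrite ?xK eqxx !orbT.
have Us8 := grow _ _ s6 Us6 hs.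
by have [g /nogood] := quadruple_tperm_conj_prod Us8
  erefl (xK a) erefl (xK c) erefl (xK e) erefl (xK h).
Qed.

End Transpositions.

(** * Automorphisms of a symmetric group *)

Lemma morph_one (G H : groupType) (f : G -> H) :
  {morph f : x y / x * y} -> f 1 = 1.
Proof. by move=> fM; apply: (mulgI (f 1)); rewrite -fM !mulg1. Qed.

Lemma morph_conj (G H : groupType) (f : G -> H) :
  {morph f : x y / x * y} -> {morph f : x y / x ^ y}.
Proof.
by move=> fM x y; apply: (mulgI (f y)); rewrite -fM !conjgE !mulKVg fM.
Qed.

Section Automorphisms.
Variable T : finType.
Implicit Types (a b c d e : T) (w x y z g : {perm T}).

Lemma transpositionE x a : transposition x -> x a != a -> x = tperm a (x a).
Proof.
case=> b [c [bc ->]]; case: (tpermP b c a) => [->|->|_ _].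
- by [].
- by rewrite [tperm c b]tpermC.
- by rewrite eqxx.
Qed.

Lemma tperm_conj_exists a b c d : a != b -> c != d ->
  exists g, tperm a b ^ g = tperm c d.
Proof.
move=> ab cd; exists (tperm a c * tperm (tperm a c b) d).
rewrite tpermJ !permM tpermL tpermL tpermD //; last by rewrite eq_sym.
by rewrite -[X in _ != X](tpermL a c) (inj_eq perm_inj) eq_sym.
Qed.

Lemma card_fix_mod p z (S : {set T}) :
    prime p -> z ^+ p = 1 -> (forall a, a \in S -> z a \in S) ->
  #|S| = #|[set a in S | z a == a]| %[mod p].
Proof.
move=> p_pr zp1 zS.
have pz : p.-group <[z]>.
  by apply: (@pnat_dvd _ p); rewrite ?pnat_id // order_dvdn zp1.
have actS : [acts <[z]>, on S | 'P].
  rewrite cycle_subG !inE; apply/subsetP => a Sa.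
  by rewrite inE /= apermE zS.
rewrite (pgroup_fix_mod pz actS); congr (_ %% _); apply: eq_card => a.
by rewrite afix_cycle // !inE sub1set inE /= apermE.
Qed.

(** The fixed points of z are permuted by w without fixed points, so their
    number is even; it is also a multiple of 3, as z has order 3. So z fixes
    none or all of the six points. *)
Lemma commuting_order3_fpf w z : #|T| = 6 ->
    w * w = 1 -> (forall a, w a != a) -> z ^+ 3 = 1 -> z != 1 ->
    w * z = z * w ->
  forall a, z a != a.
Proof.
move=> T6 ww wfpf z3 z1 wz a; apply: contra z1 => za.
pose F := [set a | z a == a].
have F3 : 3 %| #|F|.
  have := @card_fix_mod 3 z [set: T] isT z3 (fun b _ => in_setT (z b)).
  rewrite cardsT T6 => F0; rewrite /dvdn (_ : #|F| %% 3 = 6 %% 3) // F0.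
  by congr (_ %% _); apply: eq_card => b; rewrite !inE.
have F2 : 2 %| #|F|.
  have Fw b : b \in F -> w b \in F.
    by rewrite !inE -permM wz permM => /eqP->.
  rewrite /dvdn (@card_fix_mod 2 w F) //; apply/eqP; rewrite eq_card0 // => b.
  by rewrite !inE (negPf (wfpf b)) andbF.
have F6 : 6 %| #|F| by rewrite (@Gauss_dvd 2 3) // F2.
have FT : F = [set: T].
  apply/eqP; rewrite eqEcard subsetT cardsT T6 dvdn_leq //.
  by apply/card_gt0P; exists a; rewrite inE.
apply/eqP/permP => b; rewrite perm1; apply/eqP.
by have := in_setT b; rewrite -FT inE.
Qed.

Variable phi : {perm {perm T}}.
Hypothesis phiM : {morph phi : x y / x * y}.

(** If one transposition had an even image, then so would all its conjugates,
    hence every permutation, against the surjectivity of phi. *)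
Lemma perm_aut_tperm_odd a b :
  a != b -> odd_perm (phi (tperm a b)) = true.
Proof.
move=> ab; apply: contraTT isT; rewrite -eqbF_neg => /eqP even_ab.
have even_phi x : odd_perm (phi x) = false.
  have [ts -> /allP dts] := prod_tpermP x.
  elim: ts dts => [|[c d] ts IHts] dts.
    by rewrite big_nil (morph_one phiM) odd_perm1.
  rewrite big_cons phiM odd_permM IHts; last first.
    by move=> t ts_t; apply: dts; rewrite inE ts_t orbT.
  have [g <-] := tperm_conj_exists ab (dts _ (mem_head _ _)).
  by rewrite (morph_conj phiM) odd_permJ even_ab.
by have := even_phi (phi^-1 (tperm a b)); rewrite permKV odd_tperm ab.
Qed.

Lemma perm_aut_tperm a b : a != b ->
  transposition (phi (tperm a b)) \/
  #|T| = 6 /\ forall e, phi (tperm a b) e != e.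
Proof.
move=> ab; have tt : tperm a b * tperm a b = 1 by rewrite -{1}tpermV mulVg.
case: (@involution_6_products _ (phi (tperm a b))) => [|||tr|[fpf]].
- by rewrite -phiM tt (morph_one phiM).
- rewrite -(morph_one phiM) (inj_eq perm_inj).
  apply: contraNneq ab => /permP/(_ a).
  by rewrite tpermL perm1 => ->.
- move=> g; rewrite -[g](permKV phi) -(morph_conj phiM) -phiM tpermJ.
  have phiX m x : phi (x ^+ m) = phi x ^+ m.
    by elim: m => [|m IHm]; rewrite ?(morph_one phiM) // !expgS phiM IHm.
  by rewrite -phiX tperm_mul_exp6 (morph_one phiM).
- by left.
case=> [T6 | [c [d [c' [d' [cd cd' E]]]]]]; first by right.
have := perm_aut_tperm_odd ab.
by rewrite E odd_permM !odd_tperm cd cd'.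
Qed.

Section StarImage.
Hypothesis phi_tr : forall a b, a != b -> transposition (phi (tperm a b)).
Variables o p : T.
Hypothesis po : p != o.

(** The transpositions (o i) pairwise do not commute, hence neither do their
    images, which are thus pairwise intersecting transpositions: they share a
    point, unless they are the three edges (a b), (b c), (a c) of a triangle.
    In the latter case one would be a conjugate of a second one by the third,
    whereas (o i) ^ (o p) = (p i) does not move o. *)
Lemma star_image_center : exists a, forall i, i != o -> phi (tperm o i) a != a.
Proof.
pose tau i := phi (tperm o i).
have trtau i : i != o -> transposition (tau i).
  by move=> io; apply: phi_tr; rewrite eq_sym.
have ncomm i j : i != o -> j != o -> i != j -> tau i ^ tau j != tau i.
  move=> io jo ij; rewrite -(morph_conj phiM) (inj_eq perm_inj) tpermJ tpermL.
  rewrite (@tpermD _ o j i) 1?eq_sym //.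
  apply/eqP; move/permP/(_ o); rewrite tpermL tpermD // => oi.
  by move: io; rewrite oi eqxx.
have [a [b [ab tau_p]]] := trtau p po; rewrite -/(tau _) in tau_p.
have [/forallP tau_a|/forallPn[i]] :=
  boolP [forall i, (i != o) ==> (tau i a != a)].
  by exists a => i; apply/implyP/tau_a.
rewrite negb_imply negbK => /andP[io /eqP tau_i_a].
have [/forallP tau_b|/forallPn[j]] :=
  boolP [forall i, (i != o) ==> (tau i b != b)].
  by exists b => k; apply/implyP/tau_b.
rewrite negb_imply negbK => /andP[jo /eqP tau_j_b].
have ip : i != p.
  by apply: contraNneq ab => ip; rewrite -tau_i_a ip tau_p tpermL.
have jp : j != p.
  by apply: contraNneq ab => jp; rewrite -[b]tau_j_b jp tau_p tpermR.
have tau_i_b : tau i b != b.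
  apply: contraNneq (ncomm _ _ po io _) => [tib|]; last by rewrite eq_sym.
  by rewrite tau_p tpermJ tau_i_a tib.
have tau_j_a : tau j a != a.
  apply: contraNneq (ncomm _ _ po jo _) => [tja|]; last by rewrite eq_sym.
  by rewrite tau_p tpermJ tau_j_b tja.
have Ei := transpositionE (trtau i io) tau_i_b.
have Ej := transpositionE (trtau j jo) tau_j_a.
set c := tau i b in Ei tau_i_b; set d := tau j a in Ej tau_j_a.
have ij : i != j.
  by apply: contraNneq tau_i_b; rewrite /c => ->; rewrite tau_j_b.
have ca : c != a by rewrite -tau_i_a /c (inj_eq perm_inj) eq_sym.
have cd : d = c.
  apply: contraNeq (ncomm _ _ io jo ij) => dc.
  by rewrite Ei tpermJ tau_j_b Ej tpermD // eq_sym.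
have : tau i ^ tau p = tau j.
  by rewrite Ei tau_p tpermJ tpermR tpermD 1?eq_sym // Ej cd.
rewrite -(morph_conj phiM) => /perm_inj.
rewrite tpermJ tpermL (@tpermD _ o p i) 1?eq_sym //.
move/permP/(_ o); rewrite tpermL tpermD // => /eqP.
by rewrite eq_sym (negPf jo).
Qed.

(** If a is the common point of the images of the (o i), then the conjugating
    permutation must send o to a and each i to the other point moved by the
    image of (o i); as the (o i) generate, conjugation by it is phi. *)
Lemma transposition_aut_inner : exists g, forall x, phi x = x ^ g.
Proof.
have [a tau_a] := star_image_center.
pose G i := phi (tperm o i) a.
have Go : G o = a by rewrite /G tperm1 (morph_one phiM) perm1.
have tauE i : phi (tperm o i) = tperm (G o) (G i).
  have [->|io] := eqVneq i o; first by rewrite !tperm1 (morph_one phiM).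
  rewrite Go; apply: transpositionE (tau_a i io).
  by apply: phi_tr; rewrite eq_sym.
have G_inj : injective G.
  move=> i j Gij; have : tperm o i = tperm o j.
    by apply: (@perm_inj _ phi); rewrite !tauE Gij.
  by move/permP/(_ o); rewrite !tpermL.
exists (perm G_inj) => x; apply/eqP.
have grp : group_set [set x : {perm T} | phi x == x ^ perm G_inj].
  apply/group_setP; split=> [|y z]; rewrite !inE ?(morph_one phiM) ?conj1g //.
  by move=> /eqP yE /eqP zE; rewrite phiM conjMg yE zE.
have /subsetP/(_ x) : [set: {perm T}] \subset Group grp.
  rewrite -(gen_tperm o) gen_subG; apply/subsetP => _ /imsetP[i _ ->].
  by rewrite inE tauE tpermJ !permE.
by rewrite !inE; apply.
Qed.

End StarImage.

Lemma perm_aut_inner_or_exotic (o p : T) : o != p ->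
  (exists g, forall x, phi x = x ^ g) \/
  (#|T| = 6 /\ forall a b e, a != b -> phi (tperm a b) e != e).
Proof.
move=> op; have [[a [b [ab tr]]] | [T6 fpf]] := perm_aut_tperm op.
  left; apply: (@transposition_aut_inner _ o p); last by rewrite eq_sym.
  move=> c d cd; have [g <-] := tperm_conj_exists op cd.
  exists (phi g a), (phi g b); rewrite (inj_eq perm_inj); split=> //.
  by rewrite (morph_conj phiM) tr tpermJ.
right; split=> // a b e ab; have [g <-] := tperm_conj_exists op ab.
by rewrite (morph_conj phiM) -[e](permKV (phi g)) permJ (inj_eq perm_inj).
Qed.

End Automorphisms.

(** * Induction on braids, and the surjection onto the symmetric group *)

Lemma braid_ind n (P : 'B_n -> Prop) :
    P 1 -> (forall i x, P x -> P (sigma i * x)) ->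
    (forall i x, P x -> P ((sigma i)^-1 * x)) ->
  forall x, P x.
Proof.
move=> P1 Ps PsV x; rewrite -(braid_reprK x).
elim: (repr x) => [|[i b] w IHw]; first exact: P1.
rewrite -cat1s braid_classM; case: b; last exact: Ps.
by rewrite -[[:: _]]/(braid_word_inv [:: (i, false)]) braid_classV; apply: PsV.
Qed.

Lemma braid_perm_surj n (s : 'S_n) : exists x, braid_perm x = s.
Proof.
case: n s => [|n] s; first by exists 1; apply/permP => -[].
pose im := [set s : 'S_n.+1 | `[< exists x, braid_perm x = s >]].
have grp : group_set im.
  apply/group_setP; split=> [|s1 s2]; rewrite !inE.
    by apply/asboolP; exists 1; apply: morph_one (@braid_permM _).
  case/asboolP=> x <- /asboolP[y <-]; apply/asboolP; exists (x * y).
  exact: braid_permM.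
have gen_adj (i : 'I_n) : adj_tperm (n := n.+1) i \in Group grp.
  rewrite inE; apply/asboolP; exists (sigma (n := n.+1) i).
  exact: braid_perm_sigma.
have star k (lt_k : k < n.+1) : tperm ord0 (Ordinal lt_k) \in Group grp.
  elim: k lt_k => [|k IHk] lt_k.
    by rewrite (_ : Ordinal lt_k = ord0) ?tperm1 ?group1 //; apply: val_inj.
  case: k IHk lt_k => [|k] IHk lt_k.
    rewrite (_ : tperm _ _ = adj_tperm (n := n.+1) (Ordinal (lt_k : 0 < n))) //.
    by congr (tperm _ _); apply: val_inj.
  have lt_k' : k.+1 < n.+1 by exact: ltnW.
  pose i : 'I_n := Ordinal (lt_k : k.+1 < n).
  rewrite (_ : tperm _ _ =
               tperm ord0 (Ordinal lt_k') ^ adj_tperm (n := n.+1) i).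
    by rewrite groupJ.
  rewrite tpermJ; congr (tperm _ _); first by rewrite tpermD.
  rewrite (_ : Ordinal lt_k' = Ordinal (ltn_pred_ord (n := n.+1) i)).
    by rewrite tpermL; apply: val_inj.
  exact: val_inj.
have /subsetP/(_ s) : [set: 'S_n.+1] \subset Group grp.
  rewrite -(gen_tperm ord0) gen_subG; apply/subsetP => _ /imsetP[[k lt_k] _ ->].
  exact: star.
by rewrite !inE => /(_ isT)/asboolP.
Qed.

(** * Counting crossings strand by strand *)

(** The alias carries the group law of the wreath product of V by the symmetric
    group of T, which is not the componentwise one of a product type. *)
Definition wreath (V : zmodType) (T : finType) :=
  ({perm T} * {ffun T -> V})%type.

Section Wreath.
Variables (V : zmodType) (T : finType).
Local Notation W := (wreath V T).
HB.instance Definition _ := Choice.on W.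

Definition wreath_one : W := (1, [ffun=> 0%R]).
Definition wreath_mul (u v : W) : W :=
  (u.1 * v.1, [ffun k => (u.2 k + v.2 (u.1 k))%R]).
Definition wreath_inv (u : W) : W :=
  (u.1^-1, [ffun k => (- u.2 (u.1^-1%g k))%R]).

Lemma wreath_mulA : associative wreath_mul.
Proof.
move=> u v w; congr (_, _); first exact: mulgA.
by apply/ffunP => k; rewrite !ffunE /= permM GRing.addrA.
Qed.

Lemma wreath_mul1g : left_id wreath_one wreath_mul.
Proof.
case=> s c; congr (_, _); first exact: mul1g.
by apply/ffunP => k; rewrite !ffunE /= perm1 GRing.add0r.
Qed.

Lemma wreath_mulg1 : right_id wreath_one wreath_mul.
Proof.
case=> s c; congr (_, _); first exact: mulg1.
by apply/ffunP => k; rewrite !ffunE /= GRing.addr0.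
Qed.

Lemma wreath_mulVg : left_inverse wreath_one wreath_inv wreath_mul.
Proof.
case=> s c; congr (_, _); first exact: mulVg.
by apply/ffunP => k; rewrite !ffunE /= GRing.addNr.
Qed.

Lemma wreath_mulgV : right_inverse wreath_one wreath_inv wreath_mul.
Proof.
case=> s c; congr (_, _); first exact: mulgV.
by apply/ffunP => k; rewrite !ffunE /= permK GRing.addrN.
Qed.

HB.instance Definition _ := isGroup.Build W
  wreath_mulA wreath_mul1g wreath_mulg1 wreath_mulVg wreath_mulgV.
End Wreath.

Section StrandCounts.
Variables (R : nzRingType) (n : nat).
Implicit Types x y : 'B_n.

(** Of the two strands that cross in sigma i, only the one starting in position
    i is counted, so that the total count is the exponent sum. *)
Definition count_gen (i : 'I_n.-1) : wreath R 'I_n :=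
  (adj_tperm i, [ffun k : 'I_n => (val k == i)%:R%R]).

Lemma adj_tpermE (i : 'I_n.-1) k : adj_tperm i k =
  (if k == i :> nat then i.+1 else if k == i.+1 :> nat then i : nat else k)
    :> nat.
Proof.
rewrite /adj_tperm; case: tpermP => [->|->|]; rewrite /= ?eqxx //.
  by rewrite gtn_eqF.
by move/eqP; rewrite -val_eqE => /negPf-> /eqP; rewrite -val_eqE => /negPf->.
Qed.

Lemma count_gen_comm (i j : 'I_n.-1) : i.+1 < j ->
  count_gen i * count_gen j = count_gen j * count_gen i.
Proof.
move=> ij; congr (_, _); first exact: adj_tperm_comm.
apply/ffunP => k; rewrite !ffunE /= !adj_tpermE [RHS]GRing.addrC.
congr (_%:R + _%:R)%R.
  have [->|_] := eqVneq (k : nat) j.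
    by rewrite !gtn_eqF // ltnW // ltnW.
  by have [->|//] := eqVneq (k : nat) j.+1; rewrite !gtn_eqF // ltnW // ltnW.
have [->|_] := eqVneq (k : nat) i; first by rewrite !ltn_eqF // ltnW.
by have [->|//] := eqVneq (k : nat) i.+1; rewrite !ltn_eqF // ltnW.
Qed.

(** The two sides of the braid relation are half twists of three strands. Both
    count the strand starting in position i twice, the one starting in position
    i + 1 once, and the one starting in position i + 2 not at all. *)
Lemma count_gen_braid (i j : 'I_n.-1) : i.+1 = j ->
  count_gen i * count_gen j * count_gen i =
  count_gen j * count_gen i * count_gen j.
Proof.
move=> ij; congr (_, _); first exact: adj_tperm_braid.
apply/ffunP => k; rewrite !ffunE /= !permM !adj_tpermE -ij.
have i1 : (i.+1 == i :> nat) = false by rewrite gtn_eqF.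
have i2 : (i.+2 == i :> nat) = false by rewrite gtn_eqF // ltnW.
pose simpn :=
  (eqxx, eqSS, i1, i2, eq_sym (i : nat) i.+1, eq_sym (i : nat) i.+2).
move: (k : nat) => m {k}; have [->|mi] := eqVneq m i.
  by do !rewrite /= ?simpn; rewrite !GRing.addr0 GRing.add0r.
have [mE|mi1] := eqVneq m i.+1.
  by do !rewrite /= ?mE ?simpn; rewrite !GRing.addr0 !GRing.add0r.
have [mE|mi2] := eqVneq m i.+2.
  by do !rewrite /= ?mE ?simpn; rewrite !GRing.addr0.
by rewrite !(negPf mi, negPf mi1, negPf mi2).
Qed.

Definition braid_wreath : 'B_n -> wreath R 'I_n := braid_lift count_gen.

Lemma braid_wreathM : {morph braid_wreath : x y / x * y}.
Proof. exact: braid_liftM count_gen_comm count_gen_braid. Qed.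

Lemma braid_wreath_sigma i : braid_wreath (sigma i) = count_gen i.
Proof. exact: braid_lift_sigma count_gen_comm count_gen_braid i. Qed.

Lemma braid_wreath_perm x : (braid_wreath x).1 = braid_perm x.
Proof.
have fstM : {morph (fun y => (braid_wreath y).1) : y z / y * z}.
  by move=> y z; rewrite braid_wreathM.
apply: (braid_lift_uniq (@adj_tperm_comm n) (@adj_tperm_braid n) fstM) => i.
by rewrite braid_wreath_sigma.
Qed.

Definition strand_count x k : R := (braid_wreath x).2 k.

Lemma strand_countM x y k :
  strand_count (x * y) k =
  (strand_count x k + strand_count y (braid_perm x k))%R.
Proof. by rewrite /strand_count braid_wreathM ffunE braid_wreath_perm. Qed.

(** The exponent sum of x, read in R: it is additive, with value 1 at every
    generator ([total_count_sigma]). *)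
Definition total_count x : R := (\sum_k strand_count x k)%R.

Lemma total_countM x y :
  total_count (x * y) = (total_count x + total_count y)%R.
Proof.
rewrite /total_count; under eq_bigr do rewrite strand_countM.
rewrite big_split /=; congr (_ + _)%R.
by rewrite [RHS](reindex_inj (@perm_inj _ (braid_perm x))).
Qed.

Lemma total_count_sigma i : total_count (sigma i) = 1%R.
Proof.
rewrite /total_count (bigD1 (Ordinal (ltn_pred_ord i))) //= big1 => [|k ki];
  rewrite /strand_count braid_wreath_sigma ffunE.
  by rewrite eqxx GRing.addr0.
by rewrite -[i : nat]/(val (Ordinal (ltn_pred_ord i))) val_eqE (negPf ki).
Qed.

End StrandCounts.

(** * Lifting automorphisms *)

(** F is constant on the orbits of z, which all have size 3; equivalently, every
    fibre of F is a union of such orbits. *)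
Lemma sum_invariant_fpf_eq0 (T : finType) (z : {perm T}) (F : T -> 'Z_3) :
    z ^+ 3 = 1 -> (forall k, z k != k) -> (forall k, F (z k) = F k) ->
  (\sum_k F k)%R = 0%R.
Proof.
move=> z3 fpf Fz; rewrite (partition_big F xpredT) //= big1 // => u _.
rewrite (eq_bigr (fun=> u)) => [|k /eqP //]; rewrite GRing.sumr_const.
pose S := [set k | F k == u].
have S3 : 3 %| #|S|.
  rewrite /dvdn (@card_fix_mod _ 3 z) // => [|k]; last by rewrite !inE Fz.
  by rewrite eq_card0 // => k; rewrite !inE (negPf (fpf k)) andbF.
have -> : #|[pred k | F k == u]| = #|S| by apply: eq_card => k; rewrite !inE.
have /dvdnP[m ->] := S3.
rewrite -GRing.mulr_natr GRing.natrM [(3%:R)%R](_ : _ = 0)%R ?GRing.mulr0 //.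
exact: val_inj.
Qed.

(** An inner automorphism lifts to conjugation by a braid over g. *)
Lemma inner_lift n (phi : {perm 'S_n}) (g : 'S_n) :
  (forall x, phi x = x ^ g) -> exists f : 'B_n -> 'B_n, is_lift phi f.
Proof.
move=> phiE; have [b bE] := braid_perm_surj g.
exists (conjg^~ b); split=> [|x].
  split; first by move=> x y; apply: conjMg.
  by exists (conjg^~ b^-1); [apply: conjgK | apply: conjgKV].
by rewrite (morph_conj (@braid_permM n)) bE phiE.
Qed.

(** The generators are all conjugate, by the braid relations, so they all have
    the same image under a homomorphism to an abelian group. *)
Lemma additive_braid_eq0 n (V : zmodType) (t : 'B_n -> V) (i0 : 'I_n.-1) :
    (forall x y, t (x * y) = (t x + t y)%R) -> t (sigma i0) = 0%R ->
  forall x, t x = 0%R.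
Proof.
move=> tM t_i0; have tS (i j : 'I_n.-1) : i.+1 = j -> t (sigma i) = t (sigma j).
  move/sigma_braid/(congr1 t); rewrite !tM -GRing.addrA [RHS]GRing.addrC.
  exact: GRing.addIr.
have lt0 : 0 < n.-1 by exact: leq_ltn_trans (ltn_ord i0).
have t_eq0 i lt_i :
    t (sigma (Ordinal (lt_i : i < n.-1))) = t (sigma (Ordinal lt0)).
  elim: i lt_i => [|i IHi] lt_i.
    by congr (t (sigma _)); apply: val_inj.
  by rewrite -(@tS (Ordinal (ltnW lt_i))).
have t_sigma i : t (sigma i) = 0%R.
  by case: i i0 t_i0 => i lt_i [i0 lt_i0]; rewrite !t_eq0.
have t1 : t 1 = 0%R.
  by apply: (GRing.addrI (t 1)); rewrite -tM mulg1 GRing.addr0.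
move=> x; elim/braid_ind: x => [|i x tx|i x tx] //.
  by rewrite tM tx GRing.addr0.
rewrite tM tx GRing.addr0.
by apply: (GRing.addrI (t (sigma i))); rewrite -tM mulgV t1 t_sigma GRing.addr0.
Qed.

(** A lift f gives x = f (sigma 0) and h = f (sigma 2 sigma 3), which commute.
    As g = x * x is pure, comparing the strand counts of g * h and h * g shows
    that the count of g is constant along the orbits of the permutation z of h.
    This z has order 3 and commutes with the permutation of x, a
    fixed-point-free involution, so z has no fixed point either and the total
    count of g vanishes modulo 3. Then so does that of x, and that of every f y:
    this contradicts the surjectivity of f. *)
Lemma exotic_no_lift (phi : {perm 'S_6}) :
    {morph phi : x y / x * y} ->
    (forall a b e : 'I_6, a != b -> phi (tperm a b) e != e) ->
  ~ exists f : 'B_6 -> 'B_6, is_lift phi f.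
Proof.
move=> phiM fpf [f [[fM [f' fK f'K]] f_phi]].
pose s (i : nat) (lt_i : i < 5) : 'B_6 := sigma (n := 6) (Ordinal lt_i).
pose s0 := s 0 isT; pose s2 := s 2 isT; pose s3 := s 3 isT.
pose w := phi (braid_perm s0); pose z := phi (braid_perm (s2 * s3)).
have s02 : s0 * s2 = s2 * s0 by exact: sigma_comm.
have s03 : s0 * s3 = s3 * s0 by exact: sigma_comm.
have s0_23 : s0 * (s2 * s3) = s2 * s3 * s0.
  by rewrite mulgA s02 -mulgA s03 mulgA.
have tt (a b : 'I_6) : tperm a b * tperm a b = 1 by rewrite -{1}tpermV mulVg.
have ww : w * w = 1.
  by rewrite -phiM braid_perm_sigma tt (morph_one phiM).
have wz : w * z = z * w by rewrite -!phiM -!braid_permM s0_23.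
have z3 : z ^+ 3 = 1.
  have : braid_perm (s2 * s3) ^+ 3 = 1.
    rewrite braid_permM !braid_perm_sigma; apply/permP => k.
    apply/eqP; rewrite permX perm1 /= !permM -val_eqE /= !adj_tpermE /=.
    by move: k; case; do 6?case.
  move=> z3; rewrite !expgS mulg1 -!phiM -[RHS](morph_one phiM) -z3.
  by rewrite !expgS mulg1.
have z1 : z != 1.
  rewrite -(morph_one phiM) (inj_eq perm_inj) braid_permM !braid_perm_sigma.
  apply/eqP=> /permP/(_ (Ordinal (isT : 2 < 6)))/(congr1 val).
  by rewrite permM perm1 /= !adj_tpermE.
have wfpf e : w e != e by rewrite /w braid_perm_sigma; apply: fpf.
have zfpf := commuting_order3_fpf (card_ord 6) ww wfpf z3 z1 wz.
pose g := f s0 * f s0; pose h := f (s2 * s3).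
have pig : braid_perm g = 1 by rewrite braid_permM f_phi.
have gh : g * h = h * g.
  have hs0 : commute h (f s0) by rewrite /commute -!fM s0_23.
  exact: commute_sym (commuteM hs0 hs0).
have count_z k : strand_count 'Z_3 g (z k) = strand_count 'Z_3 g k.
  have := strand_countM 'Z_3 g h k.
  rewrite gh strand_countM pig perm1 GRing.addrC.
  by move/GRing.addIr; rewrite f_phi.
have g0 : total_count 'Z_3 g = 0%R.
  exact: sum_invariant_fpf_eq0 z3 zfpf count_z.
(* 2 is invertible modulo 3. *)
have tw0 : total_count 'Z_3 (f s0) = 0%R.
  move: g0; rewrite total_countM; move: (total_count _ _) => u.
  by case: u => -[|[|[|//]]] //= lt_u _; apply: val_inj.
have tfM x y :
    total_count 'Z_3 (f (x * y)) =
    (total_count 'Z_3 (f x) + total_count 'Z_3 (f y))%R.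
  by rewrite fM total_countM.
have := additive_braid_eq0 (t := fun x => total_count 'Z_3 (f x))
  tfM tw0 (f' s0).
by rewrite f'K total_count_sigma => /eqP; rewrite GRing.oner_eq0.
Qed.

Theorem proposition6p2 :
  (forall n : nat, 2 <= n -> n != 6 ->
     forall phi : {perm 'S_n}, phi \in Aut [set: 'S_n] ->
       exists f : 'B_n -> 'B_n, is_lift phi f) /\
  (forall phi : {perm 'S_6}, phi \in Aut [set: 'S_6] ->
     phi \notin Inn [set: 'S_6] ->
     ~ exists f : 'B_6 -> 'B_6, is_lift phi f).
Proof.
have morph_aut n (phi : {perm 'S_n}) :
    phi \in Aut [set: 'S_n] -> {morph phi : x y / x * y}.
  by move/Aut_morphic/morphicP=> phiM x y; rewrite phiM ?inE.
split=> [n n_gt1 n6 phi /morph_aut phiM | phi /morph_aut phiM phi_out].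
  have ot : Ordinal (ltnW n_gt1) != Ordinal n_gt1 by [].
  have [[g phiE] | [T6 _]] := perm_aut_inner_or_exotic phiM ot.
    exact: inner_lift phiE.
  by move: n6; rewrite -T6 card_ord eqxx.
have [[g phiE] | [_ fpf]] :=
  perm_aut_inner_or_exotic phiM (isT : ord0 != ord_max :> 'I_6).
  by case/InnP: phi_out; exists g.
exact: exotic_no_lift phiM fpf.
Qed.
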